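(* For any positive real numbers $m, n, p$, the following inequality holds: $$\frac{mn}{p}+\frac{np}{m}+\frac{pm}{n}+\frac{9mnp}{mn+np+pm}\geq 2(m+n+p).$$ *)

(* Defs.v *)
From Stdlib Require Export Reals.

(* Main.v *)
Require Import Defs.
From Stdlib Require Import Reals.
From Stdlib Require Import Lra.
Open Scope R_scope.

(** With x = mn, y = np, z = pm, clearing the denominator mnp(x + y + z) and
    using (mnp)^2 = xyz turns the inequality into Schur's inequality of degree 1
    for x, y, z. *)

(** Put q = mnp. Then mn/p = x^2/q and m = xz/q, and similarly for the other terms. The left side
    minus the right is (x^2 + y^2 + z^2 - 2(xy + yz + zx))/q + 9q/(x + y + z), which by q^2 = xyz is
    exactly the Schur expression over q(x + y + z). *)

Lemma schur_sorted (x y z : R) :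
  0 <= z -> z <= y -> y <= x ->
  0 <= x * (x - y) * (x - z) + y * (y - x) * (y - z) + z * (z - x) * (z - y).
Proof.
  intros hz hzy hyx.
  (* The first two Schur terms share the factor x - y; in this grouping every factor is nonnegative,
     since x + y - z >= x. *)
  replace (x * (x - y) * (x - z) + y * (y - x) * (y - z) + z * (z - x) * (z - y))
    with ((x - y) * (x - y) * (x + y - z) + z * ((x - z) * (y - z))) by ring.
  apply Rplus_le_le_0_compat; repeat apply Rmult_le_pos; lra.
Qed.

Lemma schur (x y z : R) :
  0 <= x -> 0 <= y -> 0 <= z ->
  0 <= x * (x - y) * (x - z) + y * (y - x) * (y - z) + z * (z - x) * (z - y).
Proof.
  intros hx hy hz.
  pose proof (schur_sorted x y z); pose proof (schur_sorted x z y);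
  pose proof (schur_sorted y x z); pose proof (schur_sorted y z x);
  pose proof (schur_sorted z x y); pose proof (schur_sorted z y x).
  (* By symmetry, six of the eight cases each fall under one sorted instance; the two cyclic ones
     are contradictory. *)
  destruct (Rle_lt_dec x y), (Rle_lt_dec y z), (Rle_lt_dec x z); lra.
Qed.

Theorem theorem1p6 (m n p : R) (hm : 0 < m) (hn : 0 < n) (hp : 0 < p) :
  m * n / p + n * p / m + p * m / n + 9 * m * n * p / (m * n + n * p + p * m)
    >= 2 * (m + n + p).
Proof.
  assert (hx : 0 < m * n) by (apply Rmult_lt_0_compat; assumption).
  assert (hy : 0 < n * p) by (apply Rmult_lt_0_compat; assumption).
  assert (hz : 0 < p * m) by (apply Rmult_lt_0_compat; assumption).
  assert (hd : 0 < m * n * p * (m * n + n * p + p * m))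
    by (repeat apply Rmult_lt_0_compat; lra).
  pose proof (schur (m * n) (n * p) (p * m)
                (Rlt_le _ _ hx) (Rlt_le _ _ hy) (Rlt_le _ _ hz)) as hs.
  apply Rminus_ge.
  match type of hs with 0 <= ?s =>
    replace (m * n / p + n * p / m + p * m / n
             + 9 * m * n * p / (m * n + n * p + p * m) - 2 * (m + n + p))
      with (s / (m * n * p * (m * n + n * p + p * m))) by (field; lra)
  end.
  apply Rle_ge, Rle_mult_inv_pos; assumption.
Qed.
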